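(* Let $R_{n,k}$ be as defined in the context and $\mathcal{R}(x,y)=\sum_{n,k\ge0}\frac{R_{n,k}}{n!}x^ny^k$. Then \[\mathcal{R}(x,y)-2(y-1)y\frac{\partial\mathcal{R}(x,y)}{\partial y}+(xy-1)\frac{\partial\mathcal{R}(x,y)}{\partial x}=0.\]
   Context: For $n\ge1$, $S_n$ is the set of permutations of $\{0,\dots,n-1\}$ in one-line notation. A 3-dimensional permutation of length $n$ is a pair $\Pi=(\pi^2,\pi^3)$ of elements of $S_n$ (for $n=0$, the single empty permutation); its elements are the columns $\Pi_j=(\pi^2_j,\pi^3_j)^T$, and the level of $\Pi_j$ is $\max\{\pi^2_j,\pi^3_j\}$. $\Pi$ is canonical if $\pi^2=01\cdots(n-1)$. $R_{n,k}$ is the number of canonical 3-dimensional permutations of length $n$ in which exactly $k$ distinct level values are each attained by two elements (with $R_{0,0}=1$, $R_{0,k}=0$ for $k\ge1$). *)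

(* Defs.v *)
From HB Require Import structures.
From mathcomp Require Import all_boot all_order all_fingroup all_algebra.

Set Implicit Arguments.
Unset Strict Implicit.
Unset Printing Implicit Defensive.

Import GRing.Theory.
Local Open Scope ring_scope.

(* A pair (pi^2, pi^3), each permutation being read in one-line notation as    *)
(* the word pi 0, ..., pi (n - 1).  'S_0 has one element, so there is          *)
(* exactly one (empty) 3-dimensional permutation of length 0.                  *)
Definition perm3 (n : nat) : Type := ('S_n * 'S_n)%type.

Definition level (n : nat) (P : perm3 n) (j : 'I_n) : nat :=
  maxn (P.1 j) (P.2 j).

Definition canonical3 (n : nat) (P : perm3 n) : bool :=
  [forall j : 'I_n, P.1 j == j].

(* Levels are < n, so letting the value l range over 'I_n loses nothing. *)
Definition double_levels (n : nat) (P : perm3 n) : {set 'I_n} :=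
  [set l : 'I_n | #|[set j : 'I_n | level P j == l]| == 2].

Definition Rnum (n k : nat) : nat :=
  #|[set P : perm3 n | canonical3 P & #|double_levels P| == k]|.

(* Formal power series in x, y over rat: F n k is the coefficient of x^n y^k. *)
Definition fps2 : Type := nat -> nat -> rat.

Declare Scope fps2_scope.
Delimit Scope fps2_scope with fps2.
Bind Scope fps2_scope with fps2.

Definition fps2_const (c : rat) : fps2 :=
  fun n k => if (n == 0)%N && (k == 0)%N then c else 0.
Definition fps2_x : fps2 := fun n k => ((n == 1)%N && (k == 0)%N)%:R.
Definition fps2_y : fps2 := fun n k => ((n == 0)%N && (k == 1)%N)%:R.
Definition fps2_add (F G : fps2) : fps2 := fun n k => F n k + G n k.
Definition fps2_sub (F G : fps2) : fps2 := fun n k => F n k - G n k.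
Definition fps2_mul (F G : fps2) : fps2 := fun n k =>
  \sum_(i < n.+1) \sum_(j < k.+1) F i j * G (n - i)%N (k - j)%N.
Definition fps2_dx (F : fps2) : fps2 := fun n k => n.+1%:R * F n.+1 k.
Definition fps2_dy (F : fps2) : fps2 := fun n k => k.+1%:R * F n k.+1.

Notation "0" := (fps2_const 0%R) : fps2_scope.
Notation "1" := (fps2_const 1%R) : fps2_scope.
Notation "2" := (fps2_const 2%:R%R) : fps2_scope.
Notation "F + G" := (fps2_add F G) : fps2_scope.
Notation "F - G" := (fps2_sub F G) : fps2_scope.
Notation "F * G" := (fps2_mul F G) : fps2_scope.

(* Exponential in x, ordinary in y. *)
Definition Rgf : fps2 := fun n k => (Rnum n k)%:R / (n`!)%:R.

(* Main.v *)
(* In the canonical permutation (id, s) the level l is attained at the         *)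
(* positions l (iff s l <= l) and s^-1 l (iff s^-1 l < l), so it is attained   *)
(* twice exactly when l is a cycle peak of s: s l < l and s^-1 l < l.          *)
(* Inserting a new largest letter into the cycles of s creates one peak, and   *)
(* destroys one iff the arc b -> s b it splits has a peak as an endpoint; each *)
(* of the p peaks lies on two arcs and no arc joins two peaks, so 2p of the n  *)
(* arcs preserve the number of peaks and n - 2p increase it; a new fixed point *)
(* changes nothing.  Hence                                                     *)
(*   R(n+1, k) = (2k+1) R(n, k) + (n - 2(k-1)) R(n, k-1),                      *)
(* which is the coefficient of x^n y^k in the differential equation.           *)
Require Import Defs.
From HB Require Import structures.
From mathcomp Require Import all_boot all_order all_fingroup all_algebra.
From mathcomp Require Import zify ring.

Set Implicit Arguments.
Unset Strict Implicit.
Unset Printing Implicit Defensive.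

Import GRing.Theory.
Local Open Scope nat_scope.

(** [double_levels_canonical] turns the statistic into cycle peaks, and by [sum_insert_max] every
    permutation of length n + 1 arises exactly once by inserting the maximum. [npeaks_insert] gives
    the effect of one insertion and [sum_cycle_peak_adjacent] counts the arcs of each kind; this
    yields [Rnum_rec0] and [Rnum_recS], which, divided by n!, are the equation at y^0 and at the
    positive powers of y. *)

Definition cycle_peak (n : nat) (s : 'S_n) (l : 'I_n) : bool :=
  (s l < l) && (s^-1%g l < l).

Definition npeaks (n : nat) (s : 'S_n) : nat := \sum_l cycle_peak s l.

Lemma double_levels_canonical (n : nat) (s : 'S_n) :
  double_levels (1%g, s) = [set l | cycle_peak s l].
Proof.
apply/setP => l; rewrite !inE.
have -> : [set j | level (1%g, s) j == l] =
    [set j in [:: l] | s j <= l] :|: [set j in [:: s^-1%g l] | j < l].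
  apply/setP => j; rewrite !inE /level /= perm1.
  have -> : (j == s^-1%g l) = (s j == l).
    by rewrite -[LHS](inj_eq (@perm_inj _ s)) permKV.
  rewrite -!val_eqE /=.
  have [->|neq] := eqVneq j l; first by rewrite ltnn andbF orbF; lia.
  have := neq; rewrite -(inj_eq (@perm_inj _ s)) -val_eqE /= => neqs.
  by move: neq; rewrite -val_eqE /=; lia.
have fixP : (val (s l) == val l) = (l == s^-1%g l).
  by rewrite -[in RHS](inj_eq (@perm_inj _ s)) permKV.
have valV : (l == s^-1%g l) = (val l == val (s^-1%g l)) by [].
have -> : [set j in [:: l] | s j <= l] = if s l <= l then [set l] else set0.
  by apply/setP=> j; case: ifP => h; rewrite !inE; case: eqP => [->|].
have -> : [set j in [:: s^-1%g l] | j < l] =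
    if s^-1%g l < l then [set s^-1%g l] else set0.
  by apply/setP=> j; case: ifP => h; rewrite !inE; case: eqP => [->|].
rewrite /cycle_peak; case: ifP => h1; case: ifP => h2;
  rewrite ?set0U ?setU0 ?cards0 ?cards1 ?cards2; move: fixP;
  rewrite ?valV /=; lia.
Qed.

Lemma Rnum_npeaks (n k : nat) : Rnum n k = \sum_(s : 'S_n) (npeaks s == k).
Proof.
rewrite -big_mkcond sum1dep_card /Rnum.
have pair1_inj : injective (fun s : 'S_n => (1%g, s) : perm3 n) by move=> s t [].
rewrite -(card_imset _ pair1_inj); apply: eq_card => -[p s].
have npE t : npeaks t = #|double_levels (1%g, t)|.
  by rewrite double_levels_canonical -sum1dep_card /npeaks [RHS]big_mkcond.
rewrite !inE; apply/andP/imsetP => /=.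
  case=> /forallP can /eqP card_k.
  have p1 : p = 1%g by apply/permP => j; rewrite perm1; apply/eqP/can.
  by exists s; rewrite ?inE ?npE -?p1 ?card_k.
case=> t; rewrite inE npE => t_k [-> ->]; split=> //.
by apply/forallP => j; rewrite /= perm1.
Qed.

(* Inserts the new largest letter into the cycle notation of [s], just after   *)
(* [a], or as a new fixed point when [a] is that letter itself.                *)
Definition insert_max (n : nat) (s : 'S_n) (a : 'I_n.+1) : 'S_n.+1 :=
  (tperm a ord_max * lift_perm ord_max ord_max s)%g.

Section InsertMax.
Variables (n : nat) (s : 'S_n).
Implicit Types (a : 'I_n.+1) (b l : 'I_n).

Let neq_max l : (ord_max == lift ord_max l) = false.
Proof. exact: negbTE (neq_lift _ _). Qed.

Let max_ltF l : ((ord_max : 'I_n.+1) < l) = false.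
Proof. by apply/negbTE; rewrite -leqNgt /= ltnW. Qed.

Lemma insert_maxVmax a : (insert_max s a)^-1%g ord_max = a.
Proof.
by apply: (@perm_inj _ (insert_max s a)); rewrite permKV permM tpermL lift_perm_id.
Qed.

Lemma insert_max_lift a l : a != lift ord_max l ->
  insert_max s a (lift ord_max l) = lift ord_max (s l).
Proof. by move=> ne; rewrite permM tpermD ?neq_max // lift_perm_lift. Qed.

Lemma insert_max_max b :
  insert_max s (lift ord_max b) ord_max = lift ord_max (s b).
Proof. by rewrite permM tpermR lift_perm_lift. Qed.

Lemma insert_maxV_lift a l : a != lift ord_max (s^-1%g l) ->
  (insert_max s a)^-1%g (lift ord_max l) = lift ord_max (s^-1%g l).
Proof.
move=> ne; apply: (@perm_inj _ (insert_max s a)).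
by rewrite permKV insert_max_lift // permKV.
Qed.

Lemma npeaks_recr (t : 'S_n.+1) :
  npeaks t = \sum_l cycle_peak t (lift ord_max l) + cycle_peak t ord_max.
Proof.
rewrite /npeaks big_ord_recr; congr (_ + _); apply: eq_bigr => l _.
by congr (nat_of_bool (cycle_peak t _)); apply: val_inj; rewrite /= /bump leqNgt ltn_ord.
Qed.

Lemma npeaks_insert_fixed : npeaks (insert_max s ord_max) = npeaks s.
Proof.
rewrite npeaks_recr {2}/cycle_peak insert_maxVmax ltnn andbF addn0.
apply: eq_bigr => l _; rewrite /cycle_peak.
by rewrite insert_max_lift ?insert_maxV_lift ?neq_max // !lift_max.
Qed.

(** Among the old letters only [b] and [s b] get a new neighbour; it is the maximum, so neither can
    be a peak any more. *)
Lemma cycle_peak_insert b l :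
  cycle_peak (insert_max s (lift ord_max b)) (lift ord_max l) =
  [&& cycle_peak s l, l != b & l != s b].
Proof.
rewrite /cycle_peak; have [->|ne_b] := eqVneq l b.
  rewrite [insert_max _ _ _]permM tpermL lift_perm_id lift_max.
  by rewrite max_ltF andbF.
have [->|ne_sb] := eqVneq l (s b).
  by rewrite !andbF -insert_max_max permK insert_max_max lift_max max_ltF andbF.
rewrite insert_max_lift ?(inj_eq lift_inj) 1?eq_sym //.
rewrite insert_maxV_lift ?lift_max ?andbT //.
by rewrite (inj_eq lift_inj); apply: contraNneq ne_sb => ->; rewrite permKV.
Qed.

(** The two peaks would require both [s b < b] and [b < s b]. *)
Lemma cycle_peak_adjacent b : cycle_peak s b -> cycle_peak s (s b) = false.
Proof. by rewrite /cycle_peak permK => /andP[]; lia. Qed.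

Lemma npeaks_insert b :
  npeaks (insert_max s (lift ord_max b)) + (cycle_peak s b || cycle_peak s (s b))
  = (npeaks s).+1.
Proof.
rewrite npeaks_recr {2}/cycle_peak insert_maxVmax insert_max_max !lift_max !ltn_ord.
rewrite /= addn1 addSn; congr _.+1.
(* The right-hand sum counts the peaks destroyed. It is at most 1, also when [b = s b], since a
   fixed point is no peak. *)
have -> : nat_of_bool (cycle_peak s b || cycle_peak s (s b)) =
    \sum_l (cycle_peak s l && ((l == b) || (l == s b))).
  rewrite (eq_bigr (fun l => (if l == b then nat_of_bool (cycle_peak s b) else 0) +
      (if l == s b then nat_of_bool (cycle_peak s (s b)) else 0))).
    rewrite big_split /= -!big_mkcond !big_pred1_eq.
    by have := @cycle_peak_adjacent b; case: (cycle_peak s b) => [/(_ isT) ->|_].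
  move=> l _; have [->|_] := eqVneq l b; last first.
    by have [->|_] := eqVneq l (s b); rewrite ?andbT ?andbF.
  rewrite andbT; have [eq_b|_] := eqVneq b (s b); last by rewrite addn0.
  have := @cycle_peak_adjacent b; rewrite -eq_b.
  by case: cycle_peak => // /(_ isT).
rewrite -big_split; apply: eq_bigr => l _; rewrite cycle_peak_insert.
by case: cycle_peak; do 2!case: eqP.
Qed.

(** Each peak is the start of one arc and the end of one arc, and no arc is counted for both of its
    ends. *)
Lemma sum_cycle_peak_adjacent :
  \sum_b (cycle_peak s b || cycle_peak s (s b)) = (npeaks s).*2.
Proof.
rewrite -addnn {2}/npeaks [in X in _ + X](reindex_inj (@perm_inj _ s)) -big_split.
apply: eq_bigr => b _; have := @cycle_peak_adjacent b.
by case: (cycle_peak s b) => [/(_ isT) ->|_].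
Qed.

End InsertMax.

Lemma insert_max_inj (n : nat) :
  injective (fun p : 'S_n * 'I_n.+1 => insert_max p.1 p.2).
Proof.
move=> [s a] [t b] /= eq_ins.
have eq_ab : a = b by rewrite -(insert_maxVmax s a) eq_ins insert_maxVmax.
congr (_, _) => //; move: eq_ins; rewrite eq_ab => /mulgI eq_lift.
apply/permP => l; apply: (@lift_inj _ ord_max).
by rewrite -!(lift_perm_lift ord_max) eq_lift.
Qed.

Lemma sum_insert_max (n : nat) (F : 'S_n.+1 -> nat) :
  \sum_t F t = \sum_s (F (insert_max s ord_max) +
                       \sum_b F (insert_max s (lift ord_max b))).
Proof.
have ins_bij : bijective (fun p : 'S_n * 'I_n.+1 => insert_max p.1 p.2).
  apply: inj_card_bij; first exact: insert_max_inj.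
  by rewrite card_prod !card_Sn card_ord factS mulnC.
rewrite (reindex _ (onW_bij _ ins_bij)) -(pair_bigA _ (fun s a => F (insert_max s a))).
apply: eq_bigr => s _; rewrite big_ord_recr addnC; congr (_ + _).
apply: eq_bigr => b _; congr (F (insert_max s _)).
by apply: val_inj; rewrite /= /bump leqNgt ltn_ord.
Qed.

Lemma Rnum_rec0 (n : nat) : Rnum n.+1 0 = Rnum n 0.
Proof.
rewrite !Rnum_npeaks sum_insert_max; apply: eq_bigr => s _.
rewrite npeaks_insert_fixed; have := sum_cycle_peak_adjacent s.
case: eqP => [p0|p_neq0] sum_adj.
  rewrite big1 // => b _; have := npeaks_insert s b.
  move: sum_adj; rewrite p0 => /eqP; rewrite sum_nat_eq0 => /forallP/(_ b)/eqP /= ->.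
  by rewrite addn0 => ->.
rewrite big1 // => b _; have := npeaks_insert s b.
by case: (_ || _) => /=; lia.
Qed.

(* The negative term of the recurrence is moved to the left-hand side, since   *)
(* subtraction on nat is truncated.                                            *)
Lemma Rnum_recS (n k : nat) :
  Rnum n.+1 k.+1 + k.*2 * Rnum n k =
  (k.+1.*2 + 1) * Rnum n k.+1 + n * Rnum n k.
Proof.
rewrite !Rnum_npeaks sum_insert_max !big_distrr -!big_split; apply: eq_bigr => s _ /=.
rewrite npeaks_insert_fixed.
have sum_adj := sum_cycle_peak_adjacent s.
(* The identity holds for each [s] separately. With k peaks, the n arcs split into those that gain a
   peak and the 2k that do not; with k + 1 peaks, the fixed point and 2(k + 1) arcs keep the count;
   otherwise both sides vanish. *)
have [pk|p_neq] := eqVneq (npeaks s) k.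
  have -> : (npeaks s == k.+1) = false by lia.
  rewrite !muln1 muln0 !add0n -pk -sum_adj -big_split /=.
  rewrite -[RHS](card_ord n) -sum1_card; apply: eq_bigr => b _.
  by have := npeaks_insert s b; case: (_ || _) => /=; lia.
rewrite !muln0 !addn0; have [pk|p_neqS] := eqVneq (npeaks s) k.+1.
  rewrite muln1 addnC -pk -sum_adj; congr (_ + _); apply: eq_bigr => b _.
  by have := npeaks_insert s b; case: (_ || _) => /=; lia.
rewrite muln0 big1 // => b _; have := npeaks_insert s b.
by case: (_ || _) => /=; lia.
Qed.

Local Open Scope ring_scope.

(** Multiplying by a monomial only shifts indices, so the polynomial coefficients of the equation
    are expanded into these. *)
Definition fps2_monomial (c : rat) (i j : nat) : fps2 :=
  fun n k => c * ((n == i) && (k == j))%:R.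

Lemma fps2_monomial_mul (c : rat) (i j : nat) (F : fps2) (n k : nat) :
  fps2_mul (fps2_monomial c i j) F n k =
  if (i <= n)%N && (j <= k)%N then c * F (n - i)%N (k - j)%N else 0.
Proof.
rewrite /fps2_mul /fps2_monomial.
case: ifP => [/andP[le_in le_jk]|not_le]; last first.
  apply: big1 => u _; apply: big1 => v _.
  suff -> : (val u == i) && (val v == j) = false by rewrite mulr0 mul0r.
  by apply: contraFF not_le => /andP[/eqP<- /eqP<-]; rewrite !leq_ord.
rewrite (bigD1 (inord i)) //= (bigD1 (inord j)) //= !inordK ?ltnS // !eqxx mulr1.
rewrite !big1 ?addr0 // => [u ne|v ne]; last first.
  by rewrite -(inj_eq val_inj) /= inordK // in ne; rewrite (negPf ne) mulr0 mul0r.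
apply: big1 => v _.
by rewrite -(inj_eq val_inj) /= inordK // in ne; rewrite (negPf ne) mulr0 mul0r.
Qed.

Lemma eq_fps2_mul (F G H : fps2) : F =2 G -> fps2_mul F H =2 fps2_mul G H.
Proof.
by move=> eqFG n k; apply: eq_bigr => i _; apply: eq_bigr => j _; rewrite eqFG.
Qed.

Lemma fps2_mulBl (F G H : fps2) :
  fps2_mul (fps2_sub F G) H =2 fps2_sub (fps2_mul F H) (fps2_mul G H).
Proof.
move=> n k; rewrite /fps2_sub /fps2_mul -sumrB; apply: eq_bigr => i _.
by rewrite -sumrB; apply: eq_bigr => j _; rewrite mulrBl.
Qed.

Lemma fps2_constE (c : rat) : fps2_const c =2 fps2_monomial c 0 0.
Proof.
by move=> n k; rewrite /fps2_const /fps2_monomial; case: ifP; rewrite ?mulr1 ?mulr0.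
Qed.

Lemma twoym1yE : (2 * (fps2_y - 1) * fps2_y)%fps2 =2
  fps2_sub (fps2_monomial 2%:R 0 2) (fps2_monomial 2%:R 0 1).
Proof.
have twoym1E : (2 * (fps2_y - 1))%fps2 =2
    fps2_sub (fps2_monomial 2%:R 0 1) (fps2_monomial 2%:R 0 0).
  move=> n k; rewrite (eq_fps2_mul _ (fps2_constE _)) fps2_monomial_mul !subn0.
  by rewrite /fps2_sub fps2_constE /fps2_monomial /fps2_y mulrBr !mul1r.
move=> n k; rewrite (eq_fps2_mul _ twoym1E) fps2_mulBl /fps2_sub !fps2_monomial_mul.
rewrite /fps2_monomial /fps2_y !subn0.
by case: k => [|[|[|k]]]; rewrite /= ?andbF ?andbT ?subn1 ?mulr0.
Qed.

Lemma xym1E : (fps2_x * fps2_y - 1)%fps2 =2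
  fps2_sub (fps2_monomial 1 1 1) (fps2_monomial 1 0 0).
Proof.
move=> n k; rewrite /fps2_sub fps2_constE; congr (_ - _).
have xE : fps2_x =2 fps2_monomial 1 1 0.
  by move=> u v; rewrite /fps2_monomial mul1r.
rewrite (eq_fps2_mul _ xE) fps2_monomial_mul /fps2_monomial /fps2_y !subn0.
by case: n => [|[|n]]; rewrite /= ?andbT ?mulr0.
Qed.

Theorem theorem3p3 :
  (Rgf - 2 * (fps2_y - 1) * fps2_y * fps2_dy Rgf
     + (fps2_x * fps2_y - 1) * fps2_dx Rgf)%fps2 =2 0%fps2.
Proof.
have fact_neq0 m : (m`!)%:R != 0 :> rat.
  by rewrite Num.Theory.pnatr_eq0 -lt0n fact_gt0.
have dxE n k : fps2_dx Rgf n k = (Rnum n.+1 k)%:R / (n`!)%:R.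
  by rewrite /fps2_dx /Rgf factS natrM mulrCA invfM mulVKf // Num.Theory.pnatr_eq0.
move=> n k; rewrite /fps2_add {1}/fps2_sub.
rewrite (eq_fps2_mul _ twoym1yE) (eq_fps2_mul _ xym1E) !fps2_mulBl /fps2_sub.
rewrite !fps2_monomial_mul !subn0 !leq0n /= !dxE /fps2_dy /Rgf.
have -> : fps2_const 0 n k = 0 by rewrite /fps2_const if_same.
case: k => [|k]; first by rewrite andbF Rnum_rec0 /=; ring.
(* The factor [k%:R] absorbs the boundary case k = 0, where y^2 contributes nothing; below, [n%:R]
   does the same for x at n = 0. *)
have -> : (if (1 < k.+1)%N
    then 2%:R * ((k.+1 - 2).+1%:R * ((Rnum n (k.+1 - 2).+1)%:R / n`!%:R)) else 0)
    = 2%:R * (k%:R * ((Rnum n k)%:R / n`!%:R)) :> rat.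
  by case: k => [|k]; rewrite ?mul0r ?mulr0 //= !subSS subn0.
have -> : (if (0 < n)%N && (0 < k.+1)%N
    then 1 * ((Rnum (n - 1).+1 (k.+1 - 1))%:R / (n - 1)`!%:R) else 0)
    = n%:R * ((Rnum n k)%:R / n`!%:R) :> rat.
  case: n => [|n]; rewrite ?mul0r //= !subn1 /= mul1r factS natrM.
  by rewrite [RHS]mulrCA invfM mulVKf // Num.Theory.pnatr_eq0.
rewrite /= subn1 /=.
have /(congr1 (fun m => m%:R : rat)) := Rnum_recS n k.
rewrite -!mul2n !(natrD, natrM) => /(canRL (addrK _)) ->.
by rewrite -natr1; ring.
Qed.
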